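(* For every theory $\Gamma$ and every sentence $\varphi$ of $\mathcal{L}_2$: if $\Gamma\models\varphi$, then $\Gamma\vdash\varphi$, where $\vdash$ is provability in the system consisting of the rules (axiom), (barbara), (anti), (some$_1$), (some$_2$), (darii) together with the rule (cases).
   Context: Syntax of $\mathcal{L}_2$. Fix a set $P$ of nouns and a set $R$ of verbs. Terms: every noun $p\in P$ is a term; if $r\in R$ and $x$ is a term then $(r\ \mathsf{all}\ x)$ is a term. Sentences: $(\mathsf{all}\ x\ y)$ and $(\mathsf{some}\ x\ y)$ for terms $x,y$. A theory is a set of sentences. Semantics. A model $\mathcal{M}$ is a set $M$ (possibly empty) with $[\![p]\!]\subseteq M$ for $p\in P$ and $[\![r]\!]\subseteq M\times M$ for $r\in R$; $[\![r\ \mathsf{all}\ x]\!]=\{m\in M: m\,[\![r]\!]\,n\text{ for all }n\in[\![x]\!]\}$. $\mathcal{M}\models(\mathsf{all}\ x\ y)$ iff $[\![x]\!]\subseteq[\![y]\!]$; $\mathcal{M}\models(\mathsf{some}\ x\ y)$ iff $[\![x]\!]\cap[\![y]\!]\neq\emptyset$. $\Gamma\models\varphi$ means every model of $\Gamma$ satisfies $\varphi$. Rules (for all terms $x,y,z$ and verbs $r$): (axiom) infer $(\mathsf{all}\ x\ x)$ from no premises; (barbara) from $(\mathsf{all}\ x\ y)$ and $(\mathsf{all}\ y\ z)$ infer $(\mathsf{all}\ x\ z)$; (anti) from $(\mathsf{all}\ x\ y)$ infer $(\mathsf{all}\ (r\ \mathsf{all}\ y)\ (r\ \mathsf{all}\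 x))$; (some$_1$) from $(\mathsf{some}\ x\ y)$ infer $(\mathsf{some}\ x\ x)$; (some$_2$) from $(\mathsf{some}\ x\ y)$ infer $(\mathsf{some}\ y\ x)$; (darii) from $(\mathsf{some}\ x\ y)$ and $(\mathsf{all}\ y\ z)$ infer $(\mathsf{some}\ x\ z)$. (cases): for any sentence $\varphi$, terms $x,y$ and verb $r$: given a derivation of $\varphi$ from $\Gamma\cup\{(\mathsf{some}\ x\ x)\}$ and a derivation of $\varphi$ from $\Gamma\cup\{(\mathsf{all}\ y\ (r\ \mathsf{all}\ x))\}$, one concludes $\varphi$ from $\Gamma$ (the assumptions $(\mathsf{some}\ x\ x)$ and $(\mathsf{all}\ y\ (r\ \mathsf{all}\ x))$ are withdrawn; zero or more occurrences may be withdrawn). $\Gamma\vdash\varphi$ means that there is a finite derivation of $\varphi$ using these rules whose non-withdrawn assumptions belong to $\Gamma$. *)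

(* Defs.v *)
From Stdlib Require Import Ensembles Relations.

Inductive term (P R : Type) : Type :=
| Noun (p : P)
| VerbAll (r : R) (x : term P R).

Arguments Noun {P R} p.
Arguments VerbAll {P R} r x.

Inductive sentence (P R : Type) : Type :=
| SAll (x y : term P R)
| SSome (x y : term P R).

Arguments SAll {P R} x y.
Arguments SSome {P R} x y.

Definition theory (P R : Type) : Type := Ensemble (sentence P R).

Record model (P R : Type) : Type := Model {
  carrier : Type;
  noun_interp : P -> Ensemble carrier;
  verb_interp : R -> relation carrier
}.

Arguments Model {P R} carrier noun_interp verb_interp.
Arguments carrier {P R} m.
Arguments noun_interp {P R} m p _.
Arguments verb_interp {P R} m r _ _.

Fixpoint term_interp {P R : Type} (M : model P R) (x : term P R) :
    Ensemble (carrier M) :=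
  match x with
  | Noun p => noun_interp M p
  | VerbAll r y =>
      fun m => forall n, In _ (term_interp M y) n -> verb_interp M r m n
  end.

Definition satisfies {P R : Type} (M : model P R) (phi : sentence P R) : Prop :=
  match phi with
  | SAll x y => Included _ (term_interp M x) (term_interp M y)
  | SSome x y =>
      Inhabited _ (Intersection _ (term_interp M x) (term_interp M y))
  end.

Definition is_model_of {P R : Type} (M : model P R) (Gamma : theory P R) : Prop :=
  forall psi, In _ Gamma psi -> satisfies M psi.

Definition entails {P R : Type} (Gamma : theory P R) (phi : sentence P R) : Prop :=
  forall M : model P R, is_model_of M Gamma -> satisfies M phi.

(* Natural deduction in sequent style: [derives Gamma phi] says that [phi] has
   a finite derivation tree whose open leaves lie in [Gamma].  A sentence added
   to [Gamma] in a premise of [d_cases] is a withdrawn assumption, which may be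
   used any number of times, including none. *)
Inductive derives {P R : Type} : theory P R -> sentence P R -> Prop :=
| d_assumption Gamma phi :
    In _ Gamma phi -> derives Gamma phi
| d_axiom Gamma x :
    derives Gamma (SAll x x)
| d_barbara Gamma x y z :
    derives Gamma (SAll x y) -> derives Gamma (SAll y z) ->
    derives Gamma (SAll x z)
| d_anti Gamma r x y :
    derives Gamma (SAll x y) ->
    derives Gamma (SAll (VerbAll r y) (VerbAll r x))
| d_some1 Gamma x y :
    derives Gamma (SSome x y) -> derives Gamma (SSome x x)
| d_some2 Gamma x y :
    derives Gamma (SSome x y) -> derives Gamma (SSome y x)
| d_darii Gamma x y z :
    derives Gamma (SSome x y) -> derives Gamma (SAll y z) ->
    derives Gamma (SSome x z)
| d_cases Gamma phi x y r :
    derives (Add _ Gamma (SSome x x)) phi ->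
    derives (Add _ Gamma (SAll y (VerbAll r x))) phi ->
    derives Gamma phi.

(* Main.v *)
Require Import Defs.
From Stdlib Require Import Ensembles Classical.

(** Completeness is proved by building one model of [Gamma] in which the truth
    of [phi] forces its derivability.

    The model rests on a preorder [le Gamma phi] on terms.  It is the closure
    of the sentences [SAll x y] of [Gamma] under (axiom), (barbara), (anti) and
    one more clause when [phi] is [SSome a b]: a term [x] below both [a] and
    [b] cannot be nonempty unless [phi] holds, so it is treated as empty, and
    every term is put below [VerbAll r x].  Call such an [x] refuted.

    By (cases), adding to [Gamma] the sentence [SAll x y] for [le x y] yields no
    new derivation of [phi] ([le_admissible]): in the branch where a refuted [x]
    is nonempty, (darii) derives [phi].  This works for each instance of [le]
    separately, so no maximal consistent extension of [Gamma] is needed.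

    The points of the model are the pairs [(x, y)] with [SSome x y] in [Gamma],
    together with the diagonal pairs [(x, x)] for all [x] that are not refuted.
    A point belongs to a noun [p] when one of its components lies below [p],
    and is [r]-related to another when a component of the first lies below
    [VerbAll r u] for a component [u] of the second.  The description of nouns
    then extends to all terms ([term_interp_canonical]): for [VerbAll r z],
    either [(z, z)] is a point that can serve as a test, or [z] is refuted and
    everything lies below [VerbAll r z]. *)

(** * Structural rules *)

Lemma In_Add_l {U : Type} (A : Ensemble U) (a x : U) :
  In _ A x -> In _ (Add _ A a) x.
Proof. intro H. now left. Qed.

Lemma In_Add_r {U : Type} (A : Ensemble U) (a : U) :
  In _ (Add _ A a) a.
Proof. right. constructor. Qed.

Lemma In_Add_inv_cases {U : Type} (A : Ensemble U) (a x : U) :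
  In _ (Add _ A a) x -> In _ A x \/ x = a.
Proof. intros [y Hy | y Hy]; [now left | now right; destruct Hy]. Qed.

Lemma Included_Add {U : Type} (A B : Ensemble U) (a : U) :
  Included _ A B -> Included _ (Add _ A a) (Add _ B a).
Proof.
  intros HAB x Hx. destruct (In_Add_inv_cases _ _ _ Hx) as [H | ->].
  - now apply In_Add_l, HAB.
  - apply In_Add_r.
Qed.

Section Structural.

Context {P R : Type}.
Implicit Types (Gamma Delta : theory P R) (phi psi : sentence P R).

Lemma derives_weaken Gamma Delta phi :
  derives Gamma phi -> Included _ Gamma Delta -> derives Delta phi.
Proof.
  intro H. revert Delta.
  induction H; intros Delta Hsub.
  - now apply d_assumption, Hsub.
  - apply d_axiom.
  - eapply d_barbara; eauto.
  - apply d_anti; eauto.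
  - eapply d_some1; eauto.
  - apply d_some2; eauto.
  - eapply d_darii; eauto.
  - eapply d_cases; eauto using Included_Add.
Qed.

(** Derivations of the assumptions may be grafted onto the open leaves. *)
Lemma derives_subst Gamma Delta phi :
  derives Delta phi -> (forall psi, In _ Delta psi -> derives Gamma psi) ->
  derives Gamma phi.
Proof.
  intro H. revert Gamma.
  induction H as [Delta phi H | | | | | | | Delta phi x y r H1 IH1 H2 IH2];
    intros Gamma' Hsub.
  - now apply Hsub.
  - apply d_axiom.
  - eapply d_barbara; eauto.
  - apply d_anti; eauto.
  - eapply d_some1; eauto.
  - apply d_some2; eauto.
  - eapply d_darii; eauto.
  - assert (Hadd : forall chi psi, In _ (Add _ Delta chi) psi ->
                                   derives (Add _ Gamma' chi) psi).
    { intros chi psi Hpsi.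
      destruct (In_Add_inv_cases _ _ _ Hpsi) as [Hin | ->].
      - apply derives_weaken with (1 := Hsub _ Hin).
        intros s Hs. now apply In_Add_l.
      - apply d_assumption, In_Add_r. }
    apply d_cases with x y r; eauto.
Qed.

Lemma derives_cut Gamma Delta phi psi :
  Included _ Gamma Delta -> derives Delta psi ->
  derives (Add _ Gamma psi) phi -> derives Delta phi.
Proof.
  intros Hsub Hpsi Hphi. apply derives_subst with (1 := Hphi).
  intros chi Hchi. destruct (In_Add_inv_cases _ _ _ Hchi) as [Hin | ->].
  - now apply d_assumption, Hsub.
  - exact Hpsi.
Qed.

(** Two upper bounds, each above one component of a [SSome] sentence, give a
    [SSome] sentence, even when they bound the same component. *)
Lemma derives_some_upper Gamma x y a b :
  derives Gamma (SSome x y) ->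
  (derives Gamma (SAll x a) \/ derives Gamma (SAll y a)) ->
  (derives Gamma (SAll x b) \/ derives Gamma (SAll y b)) ->
  derives Gamma (SSome a b).
Proof.
  intros Hxy Ha Hb.
  assert (Hyx := d_some2 _ _ _ Hxy).
  assert (Hmono : forall u v, derives Gamma (SSome u v) ->
      derives Gamma (SAll u a) -> derives Gamma (SAll v b) ->
      derives Gamma (SSome a b)).
  { intros u v Huv Hu Hv. apply d_darii with v; [| exact Hv].
    apply d_some2. apply d_darii with u; [| exact Hu].
    now apply d_some2. }
  destruct Ha as [Ha | Ha], Hb as [Hb | Hb];
    eauto using d_some1.
Qed.

End Structural.

(** * The preorder on terms *)

Section Preorder.

Context {P R : Type}.
Variables (Gamma : theory P R) (phi : sentence P R).

(** The order used in the canonical model.  The clause [le_refuted] makes empty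
    every term whose nonemptiness would yield [phi]; it is vacuous when [phi] is
    a [SAll] sentence. *)
Inductive le : term P R -> term P R -> Prop :=
| le_base x y : In _ Gamma (SAll x y) -> le x y
| le_refl x : le x x
| le_trans x y z : le x y -> le y z -> le x z
| le_anti r x y : le x y -> le (VerbAll r y) (VerbAll r x)
| le_refuted a b r x y :
    phi = SSome a b -> le x a -> le x b -> le y (VerbAll r x).

(** The terms to which [le_refuted] applies. *)
Definition refuted (x : term P R) : Prop :=
  exists a b, phi = SSome a b /\ le x a /\ le x b.

(** The generalization from [Gamma] to [Delta] lets the induction hypotheses be
    used one after another, and under the assumption introduced by (cases). *)
Lemma le_admissible x y :
  le x y -> forall Delta, Included _ Gamma Delta ->
  derives (Add _ Delta (SAll x y)) phi -> derives Delta phi.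
Proof.
  assert (HAdd : forall (D : theory P R) s, Included _ D (Add _ D s))
    by (intros D s t; apply In_Add_l).
  assert (Hass : forall (D : theory P R) s, derives (Add _ D s) s)
    by (intros D s; apply d_assumption, In_Add_r).
  assert (Hkeep : forall (D : theory P R) s t,
             derives D t -> derives (Add _ D s) t)
    by (intros D s t H; exact (derives_weaken _ _ _ H (HAdd D s))).
  induction 1 as [x y Hin | x | x y z _ IH1 _ IH2 | r x y _ IH
                 | a b r x y Hphi _ IHa _ IHb]; intros Delta Hsub Hd.
  - apply derives_cut with (3 := Hd); [now intros s |].
    now apply d_assumption, Hsub.
  - apply derives_cut with (3 := Hd); [now intros s | apply d_axiom].
  - apply IH1; [exact Hsub |].
    apply IH2; [intros s Hs; now apply HAdd, Hsub |].
    apply derives_cut with (3 := Hd).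
    + intros s Hs. now apply HAdd, HAdd.
    + apply d_barbara with y; auto.
  - apply IH; [exact Hsub |].
    apply derives_cut with (3 := Hd); [apply HAdd |].
    apply d_anti; auto.
  - apply d_cases with x y r; [| exact Hd].
    (* Under [SSome x x], the hypotheses [le x a] and [le x b] yield [phi]. *)
    apply IHa; [intros s Hs; now apply HAdd, Hsub |].
    apply IHb; [intros s Hs; now apply HAdd, HAdd, Hsub |].
    rewrite Hphi. apply derives_some_upper with x x; auto.
Qed.

Lemma le_admissible2 x y z w :
  le x y -> le z w ->
  derives (Add _ (Add _ Gamma (SAll x y)) (SAll z w)) phi -> derives Gamma phi.
Proof.
  intros H1 H2 Hd.
  apply (le_admissible _ _ H1); [now intros s |].
  apply (le_admissible _ _ H2); [intros s; apply In_Add_l | exact Hd].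
Qed.

(** * The canonical model *)

Definition is_point (m : term P R * term P R) : Prop :=
  In _ Gamma (SSome (fst m) (snd m)) \/ (fst m = snd m /\ ~ refuted (fst m)).

Definition point : Type := {m : term P R * term P R | is_point m}.

(** The term [u] is a component of the point [m]. *)
Definition component (m : point) (u : term P R) : Prop :=
  u = fst (proj1_sig m) \/ u = snd (proj1_sig m).

(** The point [m] lies below the term [z]; this is to be its membership in the
    interpretation of [z]. *)
Definition below (m : point) (z : term P R) : Prop :=
  exists u, component m u /\ le u z.

Definition canonical_model : model P R :=
  Model point
    (fun p m => below m (Noun p))
    (fun r m n => exists u, component n u /\ below m (VerbAll r u)).

Lemma below_le m y z : below m y -> le y z -> below m z.
Proof.
  intros [u [Hu Huy]] Hyz. exists u. split; [exact Hu |].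
  now apply le_trans with y.
Qed.

Lemma term_interp_canonical z (m : point) :
  term_interp canonical_model z m <-> below m z.
Proof.
  revert m. induction z as [p | r z IH]; intro m; simpl.
  - reflexivity.
  - split.
    + intro H. destruct (classic (refuted z)) as [[a [b [Hphi [Ha Hb]]]] | Hz].
      * exists (fst (proj1_sig m)). split; [now left |].
        now apply le_refuted with a b.
      * (* The diagonal point at [z] lies below [z], with [z] as its only
           component. *)
        set (n := exist is_point (z, z) (or_intror (conj eq_refl Hz)) : point).
        assert (Hn : below n z)
          by (exists z; split; [now left | apply le_refl]).
        destruct (H n (proj2 (IH n) Hn)) as [u [Hu Hm]].
        now destruct Hu as [-> | ->].
    + intros Hm n Hn. destruct (proj1 (IH n) Hn) as [u [Hu Huz]].
      exists u. split; [exact Hu |].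
      now apply below_le with (VerbAll r z); [| apply le_anti].
Qed.

Lemma canonical_model_of : is_model_of canonical_model Gamma.
Proof.
  intros [x y | x y] Hin; simpl.
  - intros m Hm. apply term_interp_canonical.
    apply below_le with x; [now apply term_interp_canonical | now apply le_base].
  - apply Inhabited_intro with (exist is_point (x, y) (or_introl Hin)).
    split; apply term_interp_canonical.
    + exists x. split; [now left | apply le_refl].
    + exists y. split; [now right | apply le_refl].
Qed.

Lemma canonical_model_reflects :
  satisfies canonical_model phi -> derives Gamma phi.
Proof.
  destruct phi as [a b | a b] eqn:Hphi; simpl; intro Hsat; rewrite <- Hphi.
  - (* No term is refuted, so [(a, a)] is a point. *)
    assert (Ha : ~ refuted a)
      by (intros [c [d [Hcd _]]]; rewrite Hphi in Hcd; discriminate).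
    set (m := exist is_point (a, a) (or_intror (conj eq_refl Ha)) : point).
    assert (Hm : below m a)
      by (exists a; split; [now left | apply le_refl]).
    destruct (proj1 (term_interp_canonical b m)
                (Hsat m (proj2 (term_interp_canonical a m) Hm)))
      as [u [Hu Hab]].
    assert (Hle : le a b) by now destruct Hu as [-> | ->].
    apply (le_admissible _ _ Hle); [now intros s |].
    rewrite Hphi. apply d_assumption, In_Add_r.
  - destruct Hsat as [m [m' Ha Hb]].
    destruct (proj1 (term_interp_canonical a m') Ha) as [u [Hu Hua]].
    destruct (proj1 (term_interp_canonical b m') Hb) as [v [Hv Hvb]].
    destruct m' as [[x y] [Hin | [Hdiag Hnot]]];
      unfold component in Hu, Hv; simpl in *.
    + apply (le_admissible2 _ _ _ _ Hua Hvb). rewrite Hphi.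
      apply derives_some_upper with x y.
      * now apply d_assumption, In_Add_l, In_Add_l.
      * destruct Hu as [<- | <-]; [left | right];
          apply d_assumption, In_Add_l, In_Add_r.
      * destruct Hv as [<- | <-]; [left | right];
          apply d_assumption, In_Add_r.
    + (* A diagonal point below both [a] and [b] would be refuted. *)
      subst y. exfalso. apply Hnot. exists a, b.
      destruct Hu as [-> | ->], Hv as [-> | ->]; auto.
Qed.

End Preorder.

Theorem theorem2p20 (P R : Type) (Gamma : theory P R) (phi : sentence P R) :
  entails Gamma phi -> derives Gamma phi.
Proof.
  intro H.
  apply canonical_model_reflects, H, canonical_model_of.
Qed.
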